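(* There are absolute constants $p_0,\epsilon_0\in(0,1)$ such that for any $p\le p_0$ and $\epsilon\le\epsilon_0$, finding a $(1-\epsilon)$-approximate maximum matching of a bipartite stochastic graph $G_p$ requires querying a subgraph of maximum degree $\Omega\!\left(\frac{1}{\epsilon p}\right)$.
   Context: $G_p$ is the random subgraph of a given graph $G$ containing each edge independently with probability $p$. An algorithm non-adaptively chooses a subgraph $Q$ of $G$ to query, learns which edges of $Q$ are in $G_p$, and outputs a matching $M\subseteq Q\cap E(G_p)$; it is $(1-\epsilon)$-approximate if $\mathbb{E}|M|\ge(1-\epsilon)\mathbb{E}[\mu(G_p)]$, where $\mu$ denotes maximum matching size. The statement asserts that there exist bipartite graphs $G$ for which every such algorithm must query a subgraph $Q$ of maximum degree $\Omega(1/(\epsilon p))$. *)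

(* Defs.v *)
From mathcomp Require Import all_boot all_order all_algebra.
From mathcomp Require Import reals.

Set Implicit Arguments.
Unset Strict Implicit.
Unset Printing Implicit Defensive.

Import Order.TTheory GRing.Theory Num.Theory.
Local Open Scope ring_scope.

(* A finite simple graph on V: an edge is a two-element set of vertices. *)
Record sgraph (V : finType) := SGraph {
  edges : {set {set V}};
  edges_card2 : forall e, e \in edges -> #|e| = 2%N
}.

Definition bipartite (V : finType) (G : sgraph V) : Prop :=
  exists A : {set V}, forall e, e \in edges G ->
    exists x y, [/\ x \in A, y \notin A & e = [set x; y]].

(* Spanning subgraphs of G are identified with sets F of edges of G. *)
Definition degree (V : finType) (F : {set {set V}}) (v : V) : nat :=
  #|[set e in F | v \in e]|.

Definition max_degree (V : finType) (F : {set {set V}}) : nat :=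
  \max_(v : V) degree F v.

(* [trivIset M] says that distinct members of M are disjoint. *)
Definition is_matching (V : finType) (F M : {set {set V}}) : bool :=
  (M \subset F) && trivIset M.

Definition matching_number (V : finType) (F : {set {set V}}) : nat :=
  \max_(M : {set {set V}} | is_matching F M) #|M|.

(* The probability that E(G_p) = S, for S a subset of the edges of G. *)
Definition gp_prob (R : realType) (V : finType) (G : sgraph V) (p : R)
    (S : {set {set V}}) : R :=
  \prod_(e in edges G) (if e \in S then p else 1 - p).

Definition gp_expect (R : realType) (V : finType) (G : sgraph V) (p : R)
    (f : {set {set V}} -> R) : R :=
  \sum_(S : {set {set V}} | S \subset edges G) gp_prob G p S * f S.

(* A non-adaptive, possibly randomized, algorithm on G. The query set depends
   only on the internal randomness, while the output also depends on the
   realized queried edges. On a fixed finite graph there are finitely many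
   pairs of a query set and an output rule, so a finite seed space loses no
   generality; deterministic algorithms are those with a one-point seed. *)
Record algorithm (R : realType) (V : finType) (G : sgraph V) := Algorithm {
  seed : finType;
  seed_prob : seed -> R;
  query : seed -> {set {set V}};
  output : seed -> {set {set V}} -> {set {set V}};
  seed_prob_ge0 : forall s, 0 <= seed_prob s;
  seed_prob_sum1 : \sum_(s : seed) seed_prob s = 1;
  query_sub : forall s, query s \subset edges G;
  output_matching : forall s (S : {set {set V}}),
    S \subset query s -> is_matching S (output s S)
}.

Definition expected_output (R : realType) (V : finType) (G : sgraph V) (p : R)
    (alg : algorithm R G) : R :=
  \sum_(s : seed alg) seed_prob s *
    gp_expect G p (fun S => #|output s (query s :&: S)|%:R).

Definition approximate (R : realType) (V : finType) (G : sgraph V) (p eps : R)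
    (alg : algorithm R G) : Prop :=
  (1 - eps) * gp_expect G p (fun S => (matching_number S)%:R)
    <= expected_output p alg.

(* Main.v *)
Require Import Defs.
From mathcomp Require Import all_boot all_order all_algebra.
From mathcomp Require Import reals ring lra zify.

(**
Let X and Y have n and m vertices, take the complete bipartite graph on X and Y,
and attach to each x in X its own k pendant leaves, where r = (1 - p)^k lies in
[4 eps, 8 eps]. Call x bare if none of its leaf edges is realized. About n r
vertices are bare; with m close to n r and both large, G_p matches them into Y
up to a constant fraction, on top of the n - n r vertices matched to leaves. In
a queried graph of maximum degree D, however, an edge between X and Y only helps
if it is realized and its X-end is bare, which has probability p r, so at most
D m p r further edges are gained in expectation. For D < c / (eps p) this is at
most 8 c m, and the deficit is a constant multiple of n r, hence exceeds eps n.
*)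

Set Implicit Arguments.
Unset Strict Implicit.
Unset Printing Implicit Defensive.

Import Order.TTheory GRing.Theory Num.Theory.
Local Open Scope ring_scope.

(** * Expectation over realizations and probabilities of avoiding edge sets *)

Section Expectation.
Variables (R : realType) (V : finType) (G : sgraph V) (p : R).

Lemma gp_prob_ge0 S : 0 <= p <= 1 -> 0 <= gp_prob G p S.
Proof.
by case/andP=> p0 p1; apply: prodr_ge0 => e _; case: ifP; rewrite ?subr_ge0.
Qed.

Lemma le_gp_expect (f g : {set {set V}} -> R) : 0 <= p <= 1 ->
  (forall S : {set {set V}}, S \subset edges G -> f S <= g S) ->
  gp_expect G p f <= gp_expect G p g.
Proof.
by move=> p01 fg; apply: ler_sum => S /fg; apply: ler_wpM2l; apply: gp_prob_ge0.
Qed.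

Lemma gp_expectD (f g : {set {set V}} -> R) :
  gp_expect G p (fun S => f S + g S) = gp_expect G p f + gp_expect G p g.
Proof. by rewrite -big_split; apply: eq_bigr => S _; rewrite mulrDr. Qed.

Lemma gp_expectZ a (f : {set {set V}} -> R) :
  gp_expect G p (fun S => a * f S) = a * gp_expect G p f.
Proof. by rewrite /gp_expect big_distrr; apply: eq_bigr => S _ /=; rewrite mulrCA. Qed.

Lemma gp_expect_sum (I : finType) (P : pred I) (f : I -> {set {set V}} -> R) :
  gp_expect G p (fun S => \sum_(i | P i) f i S) =
  \sum_(i | P i) gp_expect G p (f i).
Proof. by rewrite exchange_big; apply: eq_bigr => S _; rewrite big_distrr. Qed.

(** Independence by expanding a product of sums. [F e] and [H e] are the weights of [e] lying inside
    and outside [S]; putting [F e = 0] on [T] and off the edges of [G] kills every [S] that meets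
    [T] or is not a set of edges. The factor [F e + H e] is then [1 - p] on [T] and [1]
    elsewhere. *)
Lemma gp_expect_avoid (T : {set {set V}}) : T \subset edges G ->
  gp_expect G p (fun S => [disjoint T & S]%:R) = (1 - p) ^+ #|T|.
Proof.
move=> /subsetP TE.
pose F e := if e \in edges G then if e \in T then 0 else p else 0.
pose H e := if e \in edges G then 1 - p else 1.
transitivity (\prod_e (F e + H e)).
  rewrite bigA_distr /gp_expect big_mkcond /=; apply: eq_bigr => S _.
  case: ifPn => [/subsetP SE|/subsetPn[e eS eE]]; last first.
    by rewrite (bigD1 e) //= eS /F (negPf eE) mul0r.
  have [dTS|/pred0Pn[e /andP[/= eT eS]]] := boolP [disjoint T & S]; last first.
    by rewrite mulr0 (bigD1 e) //= eS /F TE // eT mul0r.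
  rewrite mulr1 /gp_prob big_mkcond; apply: eq_bigr => e _.
  rewrite /F /H; case: ifP => eE; case: ifP => // eS.
    by rewrite (disjointFl dTS eS).
  by rewrite SE in eE.
rewrite -prodr_const [RHS]big_mkcond; apply: eq_bigr => e _.
rewrite /F /H; case: ifPn => eE; case: ifPn => eT; rewrite ?add0r //.
  by rewrite addrC subrK.
by rewrite TE in eE.
Qed.

(** The total mass is 1 because every [S] avoids the empty set. *)
Lemma gp_expect_cst a : gp_expect G p (fun=> a) = a.
Proof.
have := gp_expect_avoid (sub0set _); rewrite cards0 expr0 => E1.
rewrite -[RHS]mulr1 -[in RHS]E1 -gp_expectZ; apply: eq_bigr => S _.
by rewrite disjoints_subset sub0set mulr1.
Qed.

(** The event is the difference of two avoidance events, for [T] and for [e |: T]. *)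
Lemma gp_expect_mem_avoid e (T : {set {set V}}) :
  e \in edges G -> T \subset edges G -> e \notin T ->
  gp_expect G p (fun S => ((e \in S) && [disjoint T & S])%:R) =
  p * (1 - p) ^+ #|T|.
Proof.
move=> eE TE eT.
have eTE : e |: T \subset edges G by rewrite subUset sub1set eE.
transitivity (gp_expect G p (fun S => [disjoint T & S]%:R +
                              (-1) * [disjoint e |: T & S]%:R)).
  apply: eq_bigr => S _; congr (_ * _).
  rewrite !disjoints_subset subUset sub1set in_setC.
  by case: (e \in S); case: (T \subset _) => /=;
    rewrite ?mulN1r ?subrr ?subr0 ?oppr0 ?addr0.
rewrite gp_expectD gp_expectZ !gp_expect_avoid // cardsU1 eT exprS mulN1r.
by rewrite -{1}[_ ^+ _]mul1r -mulrBl subKr.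
Qed.

End Expectation.

Lemma card_trivIset_cover (V : finType) (M : {set {set V}}) (Z : {set V}) :
  trivIset M -> (forall e, e \in M -> #|e :&: Z| = 1%N) ->
  #|M| = #|cover M :&: Z|.
Proof.
move=> trM MZ; rewrite -!sum1_card.
under [RHS]eq_bigl do rewrite in_setI.
rewrite big_trivIset_cond //; apply: eq_bigr => e eM.
by rewrite -[LHS](MZ e eM) -sum1_card; apply: eq_bigl => x; rewrite in_setI.
Qed.

Lemma card_sets (T : finType) : #|{set T}| = (2 ^ #|T|)%N.
Proof. by rewrite -[LHS]cardsT -powersetT card_powerset cardsT. Qed.

(** * The hard graph: a complete bipartite graph with pendant leaves *)

Section Gadget.
Variables n m k : nat.
Local Open Scope nat_scope.

(** The summands are X, Y and the leaves; the leaf [(x, j)] hangs at [x]. *)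
Definition vtx : finType := ('I_n + 'I_m + 'I_n * 'I_k)%type.
Definition vx (x : 'I_n) : vtx := inl (inl x).
Definition vy (y : 'I_m) : vtx := inl (inr y).
Definition cross (u : 'I_n * 'I_m) : {set vtx} := [set vx u.1; vy u.2].
Definition leaf (u : 'I_n * 'I_k) : {set vtx} := [set vx u.1; inr u].
Definition gadget_edges :=
  [set cross u | u : 'I_n * 'I_m] :|: [set leaf u | u : 'I_n * 'I_k].

Lemma gadget_edgesP e :
  reflect ((exists u, e = cross u) \/ (exists u, e = leaf u))
    (e \in gadget_edges).
Proof.
apply: (iffP setUP) => -[].
- by case/imsetP=> u _ ->; left; exists u.
- by case/imsetP=> u _ ->; right; exists u.
- by case=> u ->; left; apply: imset_f.
- by case=> u ->; right; apply: imset_f.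
Qed.

Lemma cross_gadget u : cross u \in gadget_edges.
Proof. by apply/gadget_edgesP; left; exists u. Qed.

Lemma leaf_gadget u : leaf u \in gadget_edges.
Proof. by apply/gadget_edgesP; right; exists u. Qed.

Lemma gadget_card2 e : e \in gadget_edges -> #|e| = 2.
Proof. by case/gadget_edgesP=> -[u ->]; rewrite cards2. Qed.

Definition gadget := SGraph gadget_card2.

Definition vX := [set vx x | x : 'I_n].
Definition vY := [set vy y | y : 'I_m].

Lemma vx_inj : injective vx. Proof. by move=> x x' []. Qed.
Lemma vy_inj : injective vy. Proof. by move=> x x' []. Qed.

Lemma vx_vX x : vx x \in vX. Proof. exact: imset_f. Qed.
Lemma vy_vY y : vy y \in vY. Proof. exact: imset_f. Qed.

Lemma notin_vX v : (forall x, v != vx x) -> v \notin vX.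
Proof. by move=> vN; apply/imsetP => -[x _ /eqP]; apply/negP. Qed.

Lemma notin_vY v : (forall y, v != vy y) -> v \notin vY.
Proof. by move=> vN; apply/imsetP => -[y _ /eqP]; apply/negP. Qed.

Lemma gadget_bipartite : bipartite gadget.
Proof.
exists vX => e /gadget_edgesP[] [u ->]; exists (vx u.1).
  by exists (vy u.2); split; rewrite ?vx_vX ?notin_vX.
by exists (inr u); split; rewrite ?vx_vX ?notin_vX.
Qed.

Lemma leaf_inj : injective leaf.
Proof.
move=> u u' /setP/(_ (inr u)); rewrite !inE /= eqxx.
by move/esym/eqP => [].
Qed.

Lemma cross_leafF u u' : (cross u == leaf u') = false.
Proof. by apply/eqP => /setP/(_ (vy u.2)); rewrite !inE /= eqxx. Qed.

Lemma vx_cross x u : (vx x \in cross u) = (x == u.1).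
Proof. by rewrite !inE /= orbF. Qed.

Lemma vx_leaf x u : (vx x \in leaf u) = (x == u.1).
Proof. by rewrite !inE /= orbF. Qed.

Lemma vy_cross y u : (vy y \in cross u) = (y == u.2).
Proof. by rewrite !inE. Qed.

Lemma cross_inj : injective cross.
Proof.
move=> [x y] [x' y'] /setP E.
have := E (vx x); rewrite !vx_cross eqxx => /esym/eqP ->.
by have := E (vy y); rewrite !vy_cross eqxx => /esym/eqP ->.
Qed.

Lemma card_crossX u : #|cross u :&: vX| = 1.
Proof.
apply/eqP/cards1P; exists (vx u.1); apply/setP=> v; rewrite !inE.
have [->|_] := eqVneq v; first by rewrite vx_vX.
by have [->|_] //= := eqVneq v; rewrite (negPf (notin_vX _)).
Qed.

Lemma card_leafX u : #|leaf u :&: vX| = 1.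
Proof.
apply/eqP/cards1P; exists (vx u.1); apply/setP=> v; rewrite !inE.
have [->|_] := eqVneq v; first by rewrite vx_vX.
by have [->|_] //= := eqVneq v; rewrite (negPf (notin_vX _)).
Qed.

Lemma card_crossY u : #|cross u :&: vY| = 1.
Proof.
apply/eqP/cards1P; exists (vy u.2); apply/setP=> v; rewrite !inE.
have [->|_] := eqVneq v; first by rewrite (negPf (notin_vY _)).
by have [->|_] //= := eqVneq v; rewrite vy_vY.
Qed.

Lemma card_gadgetX e : e \in gadget_edges -> #|e :&: vX| = 1.
Proof. by case/gadget_edgesP=> -[u ->]; rewrite ?card_crossX ?card_leafX. Qed.

Definition leaves x := [set leaf (x, j) | j : 'I_k].

Lemma card_leaves x : #|leaves x| = k.
Proof. by rewrite card_imset ?card_ord // => j j' /leaf_inj[]. Qed.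

Lemma leaves_sub x : leaves x \subset gadget_edges.
Proof. by apply/subsetP=> e /imsetP[j _ ->]; apply: leaf_gadget. Qed.

Lemma disjoint_leaves x x' : x != x' -> [disjoint leaves x & leaves x'].
Proof.
move=> xx'; apply/pred0P=> e /=; apply/andP=> -[/imsetP[j _ ->]].
by case/imsetP=> j' _ /leaf_inj[] /eqP; rewrite (negPf xx').
Qed.

Lemma cross_leavesF u x : cross u \in leaves x = false.
Proof. by apply/imsetP=> -[j _ /eqP]; rewrite cross_leafF. Qed.

(** * Deterministic bounds on matchings in terms of bare vertices *)

Definition bare (S : {set {set vtx}}) := [set x | [disjoint leaves x & S]].

(* Edges of [M] at non-bare vertices are counted by their X-end; the others are
   X-Y edges, since a bare vertex has no leaf edge in [S]. *)
Lemma matching_upper (Q S M : {set {set vtx}}) :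
  Q \subset gadget_edges -> is_matching (Q :&: S) M ->
  #|M| <= #|~: bare S| +
          #|[set u | (cross u \in Q) && ((cross u \in S) && (u.1 \in bare S))]|.
Proof.
move=> QE /andP[/subsetP MQ trM].
rewrite -(cardsID [set e : {set vtx} | [disjoint e & vx @: bare S]] M); apply: leq_add.
  set M1 := _ :&: _.
  have M1M : M1 \subset M by rewrite subsetIl.
  rewrite (card_trivIset_cover (Z := vX) (trivIsetS M1M trM)); last first.
    move=> e /setIP[/MQ/setIP[eQ _] _]; apply: card_gadgetX.
    exact: (subsetP QE).
  rewrite -(card_imset _ vx_inj); apply/subset_leq_card/subsetP => v.
  case/setIP=> /bigcupP[e /setIP[_]]; rewrite inE => dis ve /imsetP[x _ vE].
  subst v; apply: imset_f; rewrite in_setC; apply/negP => xb.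
  by rewrite (disjointFl dis) ?imset_f in ve.
rewrite -(card_imset _ cross_inj); apply/subset_leq_card/subsetP => e.
case/setDP=> /MQ/setIP[eQ eS]; rewrite inE => /pred0Pn[v /andP[/= ve /imsetP[x xb vE]]].
subst v; case/gadget_edgesP: (subsetP QE _ eQ) => -[u eE]; subst e.
  by apply: imset_f; rewrite vx_cross in ve; rewrite inE eQ eS -(eqP ve).
move: xb; rewrite vx_leaf in ve; rewrite inE => dS.
have : leaf u \in leaves x.
  by apply/imsetP; exists u.2; rewrite // (eqP ve) -surjective_pairing.
by move/(disjointFr dS); rewrite eS.
Qed.

(* [A] and [B] are the vertices of X and Y missed by a maximum matching of the
   edges of [S] other than the X-Y edges at non-bare vertices: with these edges
   removed, maximality forces every non-bare vertex to be matched to a leaf. *)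
Lemma matching_lower (S : {set {set vtx}}) : S \subset gadget_edges ->
  exists (A : {set 'I_n}) (B : {set 'I_m}),
  [/\ [disjoint cross @: setX A B & S], n <= matching_number S + #|A|
    & #|A| + m <= #|bare S| + #|B|].
Proof.
move=> SE.
pose F := S :\: [set cross u | u in [pred u | u.1 \notin bare S]].
have FS : F \subset S by apply: subsetDl.
have [|M MF Mmax] := @eq_bigmax_cond _ (is_matching F) (fun M => #|M|).
  apply/card_gt0P; exists set0; rewrite unfold_in /is_matching sub0set.
  by apply/trivIsetP=> e; rewrite inE.
have /andP[/subsetP MsF trM] := MF.
have ME e : e \in M -> e \in gadget_edges.
  by move/MsF/(subsetP FS)/(subsetP SE).
(* A matching of maximum size in [F] cannot be extended by an edge. *)
have addM e : e \in F -> [disjoint e & cover M] -> False.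
  move=> eF eM.
  have [||tr' eNM] := @trivIsetU1 _ e M _ trM.
  - move=> f fM; apply: disjointWr eM; exact: bigcup_sup fM.
  - by apply/negP=> /ME/gadget_card2; rewrite cards0.
  have : #|e |: M| <= #|M|.
    rewrite -Mmax; apply: (@leq_bigmax_cond _ (is_matching F) (fun M => #|M|)).
    rewrite /is_matching tr' subUset sub1set eF andbT.
    by apply/subsetP.
  by rewrite cardsU1 eNM ltnn.
pose A := [set x | vx x \notin cover M].
pose B := [set y | vy y \notin cover M].
have cardA : #|M| + #|A| = n.
  rewrite (card_trivIset_cover trM (fun e eM => card_gadgetX (ME e eM))).
  have -> : cover M :&: vX = vx @: ~: A.
    apply/setP=> v; apply/setIP/imsetP => [[vM /imsetP[x _ vE]]|[x]].
      by exists x; rewrite // !inE negbK -vE.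
    by rewrite !inE negbK => xM ->; rewrite imset_f.
  by rewrite card_imset; [rewrite addnC cardsC card_ord | exact: vx_inj].
(* If an unmatched [x] had a realized leaf edge, that edge could extend [M]: the leaf has no other
   edge, so it is unmatched too. *)
have Abare : A \subset bare S.
  apply/subsetP=> x; rewrite inE => xM; apply/negPn/negP.
  rewrite inE => /pred0Pn[e /andP[/= /imsetP[j _ ->]] jS].
  have jF : leaf (x, j) \in F.
    rewrite inE jS andbT; apply/imsetP=> -[u _ /esym/eqP].
    by rewrite cross_leafF.
  apply: (addM _ jF); apply/pred0P=> v /=; apply/andP=> -[].
  case/set2P=> ->; first by rewrite (negPf xM).
  case/bigcupP=> f fM jf; have := MsF _ fM => fF.
  have : f = leaf (x, j).
    case/gadget_edgesP: (ME _ fM) => -[u fE]; move: jf; rewrite fE !inE //=.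
    by move=> /eqP[->].
  move=> fE; case/negP: xM; apply/bigcupP; exists f => //.
  by rewrite fE vx_leaf.
exists A, B; split.
- apply/pred0P=> e /=; apply/andP=> -[/imsetP[[x y] /setXP[/= xA yB] ->]] eS.
  have eF : cross (x, y) \in F.
    rewrite inE eS andbT; apply/imsetP=> -[u].
    by rewrite inE => uA /cross_inj uE; case/negP: uA; rewrite -uE (subsetP Abare).
  rewrite !inE in xA yB.
  apply: (addM _ eF); apply/pred0P=> v /=; apply/andP=> -[].
  by case/set2P=> ->; apply/negP.
- rewrite -{1}cardA leq_add2r.
  apply: (@leq_bigmax_cond _ (is_matching S) (fun M => #|M|)).
  by rewrite /is_matching trM andbT; apply: subset_trans FS; apply/subsetP.
pose Mc := M :&: [set cross u | u : 'I_n * 'I_m].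
have McM : Mc \subset M by apply: subsetIl.
have trMc := trivIsetS McM trM.
have cardB : #|Mc| + #|B| = m.
  rewrite (card_trivIset_cover (Z := vY) trMc); last first.
    by move=> e /setIP[_ /imsetP[u _ ->]]; apply: card_crossY.
  have -> : cover Mc :&: vY = vy @: ~: B.
    apply/setP=> v; apply/setIP/imsetP =>
      [[/bigcupP[e /setIP[eM _] ve] /imsetP[y _ vE]]|[y]].
      by exists y; rewrite // !inE negbK -vE; apply/bigcupP; exists e.
    rewrite !inE negbK => /bigcupP[e eM ye] ->; rewrite imset_f //; split=> //.
    apply/bigcupP; exists e => //; rewrite inE eM /=.
    case/gadget_edgesP: (ME _ eM) => -[u eE]; rewrite eE ?imset_f //.
    by move: ye; rewrite eE !inE.
  by rewrite card_imset; [rewrite addnC cardsC card_ord | exact: vy_inj].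
(* Each X-Y edge of [M] has a bare X-end, by the choice of [F], and that end is matched, hence
   outside [A]. *)
have : #|Mc| <= #|bare S :\: A|.
  rewrite (card_trivIset_cover (Z := vX) trMc); last first.
    by move=> e /setIP[_ /imsetP[u _ ->]]; apply: card_crossX.
  rewrite -(card_imset _ vx_inj); apply/subset_leq_card/subsetP => v.
  case/setIP=> /bigcupP[e /setIP[eM /imsetP[u _ eE]] ve] /imsetP[x _ vE].
  subst v e; rewrite vx_cross in ve; apply: imset_f; rewrite inE.
  apply/andP; split.
    by rewrite inE negbK; apply/bigcupP; exists (cross u); rewrite ?vx_cross.
  move: (MsF _ eM); rewrite inE => /andP[+ _]; apply: contraNT => xb.
  by apply: imset_f; rewrite inE -(eqP ve).
rewrite cardsDS // => leMc.
have leA := subset_leq_card Abare.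
by move: leMc leA cardB; move: #|Mc| #|bare S| #|A| #|B| => a b c d; lia.
Qed.

(** * Moments of the bare count, and expected matching sizes *)

Section GadgetExpectation.
Variables (R : realType) (p : R).
Hypothesis p01 : (0 <= p <= 1)%R.
Local Open Scope ring_scope.
Let r := (1 - p) ^+ k.

Lemma card_bare (S : {set {set vtx}}) :
  #|bare S|%:R = \sum_x [disjoint leaves x & S]%:R :> R.
Proof. by rewrite -natr_sum -sum1dep_card big_mkcond. Qed.

Lemma expect_bare : gp_expect gadget p (fun S => #|bare S|%:R) = n%:R * r.
Proof.
under [LHS]eq_bigr do rewrite card_bare.
rewrite -/(gp_expect gadget p _) gp_expect_sum.
under eq_bigr do rewrite gp_expect_avoid ?leaves_sub // card_leaves.
by rewrite sumr_const card_ord mulr_natl.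
Qed.

(** Distinct X-vertices have disjoint leaf sets, so they are bare independently; only the diagonal
    pairs exceed [r ^+ 2], by at most [r] each. *)
Lemma expect_bare_sqr :
  gp_expect gadget p (fun S => #|bare S|%:R ^+ 2) <= n%:R * r + (n%:R * r) ^+ 2.
Proof.
have r0 : 0 <= r by case/andP: p01 => _ ?; rewrite exprn_ge0 // subr_ge0.
under [leLHS]eq_bigr do rewrite card_bare expr2 big_distrlr pair_big /=.
rewrite -/(gp_expect gadget p _) gp_expect_sum.
apply: (@le_trans _ _ (\sum_(u : 'I_n * 'I_n) ((u.1 == u.2)%:R * r + r ^+ 2))).
  apply: ler_sum => -[x x'] _ /=.
  have -> : gp_expect gadget p (fun S =>
      [disjoint leaves x & S]%:R * [disjoint leaves x' & S]%:R) =
      (1 - p) ^+ #|leaves x :|: leaves x'|.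
    rewrite -(@gp_expect_avoid _ _ gadget); last by rewrite subUset !leaves_sub.
    apply: eq_bigr => S _; congr (_ * _).
    by rewrite !disjoints_subset subUset -natrM mulnb.
  have [<-|xx'] := eqVneq x x'.
    by rewrite setUid card_leaves mul1r lerDl exprn_ge0.
  move: (disjoint_leaves xx'); rewrite -leq_card_setU => /eqP ->.
  by rewrite !card_leaves exprD mul0r add0r.
have -> : (n%:R * r) ^+ 2 = r ^+ 2 *+ (n * n) :> R.
  by rewrite exprMn -natrX mulr_natl.
rewrite big_split /= sumr_const card_prod card_ord lerD2r.
rewrite -(pair_big xpredT xpredT (fun x x' : 'I_n => (x == x')%:R * r)) /=.
under eq_bigr => x _.
  rewrite (bigD1 x) //= eqxx mul1r big1 ?addr0; last first.
    by move=> x'; rewrite eq_sym => /negPf ->; rewrite mul0r.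
over.
by rewrite sumr_const card_ord mulr_natl.
Qed.

(** A count rather than an indicator, so that the union bound is linearity of expectation. *)
Definition empty_rectangles s (S : {set {set vtx}}) : R :=
  \sum_(AB : {set 'I_n} * {set 'I_m} | (s <= #|AB.1|)%N && (s <= #|AB.2|)%N)
    [disjoint cross @: setX AB.1 AB.2 & S]%:R.

Lemma expect_empty_rectangles s :
  gp_expect gadget p (empty_rectangles s) <= 2 ^+ (n + m) * (1 - p) ^+ (s * s).
Proof.
have q0 : 0 <= 1 - p by case/andP: p01 => _ ?; rewrite subr_ge0.
have q1 : 1 - p <= 1 by case/andP: p01 => ? _; rewrite lerBlDr lerDl.
rewrite gp_expect_sum.
apply: (@le_trans _ _ (\sum_(AB : {set 'I_n} * {set 'I_m}) (1 - p) ^+ (s * s))).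
  rewrite big_mkcond; apply: ler_sum => -[A B] _ /=.
  case: ifP => [/andP[sA sB]|_]; last exact: exprn_ge0.
  rewrite gp_expect_avoid; last first.
    by apply/subsetP=> e /imsetP[u _ ->]; apply: cross_gadget.
  rewrite card_imset ?cardsX; last exact: cross_inj.
  by apply: ler_wiXn2l => //; apply: leq_mul.
by rewrite sumr_const card_prod !card_sets !card_ord -[leLHS]mulr_natl natrM !natrX exprD.
Qed.

(** Counting at the Y-ends gives the factor [m], which is smaller than [n] by about the factor [r]
    in the application. *)
Lemma card_query_cross (Q : {set {set vtx}}) :
  (#|[set u | cross u \in Q]| <= max_degree Q * m)%N.
Proof.
rewrite -sum1dep_card.
rewrite -(pair_big_dep xpredT (fun x y => cross (x, y) \in Q) (fun _ _ => 1%N)) /=.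
rewrite (exchange_big_dep xpredT) //= mulnC -[X in (X * _)%N](card_ord m) -sum_nat_const.
apply: leq_sum => y _; apply: leq_trans (leq_bigmax (vy y)).
rewrite sum1dep_card -(card_imset _ (f := fun x => cross (x, y))).
  apply/subset_leq_card/subsetP => e /imsetP[x]; rewrite inE => xQ ->.
  by rewrite in_set xQ vy_cross eqxx.
by move=> x x' /cross_inj[].
Qed.

(** An X-Y edge is not a leaf edge, so its being realized is independent of its X-end being bare;
    this yields [p * r] per queried edge. *)
Lemma expect_query_le (Q : {set {set vtx}}) :
  gp_expect gadget p (fun S =>
    #|~: bare S|%:R +
    #|[set u | (cross u \in Q) && ((cross u \in S) && (u.1 \in bare S))]|%:R)
  <= n%:R - n%:R * r + (max_degree Q)%:R * m%:R * (p * r).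
Proof.
have r0 : 0 <= r by case/andP: p01 => _ ?; rewrite exprn_ge0 // subr_ge0.
rewrite gp_expectD; apply: lerD.
  rewrite -expect_bare -[n%:R](gp_expect_cst gadget p) -mulN1r -gp_expectZ.
  rewrite -gp_expectD le_eqVlt; apply/orP; left; apply/eqP.
  apply: eq_bigr => S _; congr (_ * _); rewrite mulN1r; apply/eqP.
  by rewrite eq_sym subr_eq -natrD addnC cardsC card_ord.
have -> : gp_expect gadget p (fun S =>
  #|[set u | (cross u \in Q) && ((cross u \in S) && (u.1 \in bare S))]|%:R) =
  gp_expect gadget p (fun S => \sum_(u | cross u \in Q)
    ((cross u \in S) && [disjoint leaves u.1 & S])%:R).
  apply: eq_bigr => S _; congr (_ * _).
  rewrite -natr_sum -sum1dep_card -big_mkcondr /=; congr _%:R.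
  by apply: eq_bigl => u; rewrite inE.
rewrite gp_expect_sum.
under eq_bigr => u _.
  rewrite gp_expect_mem_avoid ?leaves_sub ?cross_gadget ?cross_leavesF //.
  rewrite card_leaves.
over.
rewrite sumr_const -[leLHS]mulr_natl -natrM; apply: ler_wpM2r.
  by rewrite mulr_ge0 //; case/andP: p01.
by rewrite ler_nat -cardsE card_query_cross.
Qed.

(* The loss [|bare S| - m] is bounded by [|bare S|^2 / (4 m)], so that a second
   moment suffices and no concentration of [|bare S|] is needed. *)
Lemma matching_number_ge s (S : {set {set vtx}}) :
  S \subset gadget_edges -> (0 < m)%N ->
  n%:R - s%:R - #|bare S|%:R ^+ 2 / (4 * m%:R)
    - n%:R * empty_rectangles s S
  <= (matching_number S)%:R :> R.
Proof.
move=> SE m0; have m0R : 0 < m%:R :> R by rewrite ltr0n.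
have [A [B [dAB leA leAB]]] := matching_lower SE.
have sqr0 : 0 <= #|bare S|%:R ^+ 2 / (4 * m%:R) :> R.
  by rewrite divr_ge0 ?sqr_ge0 // mulr_ge0 // ltW.
have bareE : #|bare S|%:R - m%:R <= #|bare S|%:R ^+ 2 / (4 * m%:R) :> R.
  rewrite ler_pdivlMr ?mulr_gt0 // -subr_ge0.
  have -> : #|bare S|%:R ^+ 2 - (#|bare S|%:R - m%:R) * (4 * m%:R) =
    (#|bare S|%:R - 2 * m%:R) ^+ 2 :> R by ring.
  exact: sqr_ge0.
set bad := empty_rectangles s S.
have bad0 : 0 <= bad by apply: sumr_ge0 => ? _; apply: ler0n.
have nbad0 : 0 <= n%:R * bad by rewrite mulr_ge0.
have mu0 : 0 <= (matching_number S)%:R :> R by apply: ler0n.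
have s0 : 0 <= s%:R :> R by apply: ler0n.
have : n%:R <= (matching_number S)%:R + #|A|%:R :> R by rewrite -natrD ler_nat.
have : #|A|%:R + m%:R <= #|bare S|%:R + #|B|%:R :> R by rewrite -!natrD ler_nat.
have [sA|/ltnW] := leqP s #|A|; last first.
  by rewrite -(ler_nat R); lra.
have [sB|/ltnW] := leqP s #|B|; last first.
  by rewrite -(ler_nat R); lra.
move=> _ _.
(* When both sides reach [s], the pair [(A, B)] is itself counted, and the penalty [n%:R * bad]
   makes the lower bound nonpositive. *)
have bad1 : 1 <= bad.
  rewrite /bad /empty_rectangles (bigD1 (A, B)) /= ?sA ?sB // dAB lerDl.
  by apply: sumr_ge0 => ? _; apply: ler0n.
have : n%:R * 1 <= n%:R * bad :> R by apply: ler_wpM2l.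
by rewrite mulr1; lra.
Qed.

Lemma expect_matching_number_ge s : (0 < m)%N ->
  n%:R - s%:R - (n%:R * r + (n%:R * r) ^+ 2) / (4 * m%:R)
    - n%:R * (2 ^+ (n + m) * (1 - p) ^+ (s * s))
  <= gp_expect gadget p (fun S => (matching_number S)%:R).
Proof.
move=> m0; have m0R : 0 < m%:R :> R by rewrite ltr0n.
apply: (@le_trans _ _ (gp_expect gadget p (fun S =>
    n%:R - s%:R - #|bare S|%:R ^+ 2 / (4 * m%:R) - n%:R * empty_rectangles s S)));
  last by apply: le_gp_expect => // S SE; apply: matching_number_ge.
have -> : gp_expect gadget p (fun S =>
    n%:R - s%:R - #|bare S|%:R ^+ 2 / (4 * m%:R) - n%:R * empty_rectangles s S) =
  gp_expect gadget p (fun S => (n%:R - s%:R) +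
    ((- (4 * m%:R)^-1) * #|bare S|%:R ^+ 2 + (- n%:R) * empty_rectangles s S)).
  apply: eq_bigr => S _; congr (_ * _).
  by rewrite addrA !mulNr [_^-1 * _]mulrC.
rewrite gp_expectD gp_expect_cst gp_expectD !gp_expectZ !mulNr addrA.
apply: lerB; last by apply: ler_wpM2l; [apply: ler0n | apply: expect_empty_rectangles].
apply: lerB => //; rewrite [leRHS]mulrC; apply: ler_wpM2l.
  by rewrite invr_ge0 mulr_ge0 // ltW.
exact: expect_bare_sqr.
Qed.

(** Seeds of probability zero carry no weight in the average, so the degree bound is only asked of
    the others. *)
Lemma expected_output_le (alg : algorithm R gadget) (d : R) :
  (forall t : seed alg, 0 < seed_prob t -> (max_degree (query t))%:R <= d) ->
  expected_output p alg <= n%:R - n%:R * r + d * m%:R * (p * r).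
Proof.
move=> deg.
have r0 : 0 <= r by case/andP: p01 => _ ?; rewrite exprn_ge0 // subr_ge0.
have p0 : 0 <= p by case/andP: p01.
rewrite -[leRHS]mul1r -[X in _ <= X * _](seed_prob_sum1 alg) big_distrl /=.
apply: ler_sum => t _; have := seed_prob_ge0 t.
rewrite le_eqVlt => /predU1P[<-|pt]; first by rewrite !mul0r.
apply: (ler_wpM2l (ltW pt)).
apply: (@le_trans _ _ (n%:R - n%:R * r
    + (max_degree (query t))%:R * m%:R * (p * r))); last first.
  by rewrite lerD2l !ler_wpM2r ?mulr_ge0 ?ler0n // deg.
apply: le_trans (expect_query_le (query t)); apply: le_gp_expect => // S SE.
rewrite -natrD ler_nat; apply: matching_upper; first exact: query_sub.
exact/output_matching/subsetIl.
Qed.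

End GadgetExpectation.

End Gadget.

(** * Choice of the parameters, and the contradiction *)

Lemma exists_expr_le (R : realType) (p a : R) : 0 < p <= 1 -> 0 < a ->
  exists k, (1 - p) ^+ k <= a.
Proof.
case/andP=> p0 p1 a0; have q0 : 0 <= 1 - p by rewrite subr_ge0.
(* Bernoulli's inequality: [(1 - p)^j <= 1 / (1 + j p)]. *)
have bern j : (1 - p) ^+ j * (1 + j%:R * p) <= 1.
  elim: j => [|j IH]; first by rewrite expr0 mul0r addr0 mulr1.
  apply: le_trans IH; rewrite exprSr -mulrA ler_wpM2l ?exprn_ge0 //.
  rewrite -natr1; have : 0 <= j%:R * p ^+ 2 + p ^+ 2.
    by rewrite addr_ge0 ?sqr_ge0 // mulr_ge0 ?sqr_ge0.
  lra.
have pa0 : 0 <= (p * a)^-1 by rewrite invr_ge0 mulr_ge0 // ltW.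
exists (Num.bound (p * a)^-1).
set j := Num.bound _; have /ltW : (p * a)^-1 < j%:R := archi_boundP pa0.
rewrite -[_^-1]mul1r ler_pdivrMr ?mulr_gt0 // mulrA => ja.
have d0 : 0 < 1 + j%:R * p by rewrite ltr_pwDl // mulr_ge0 // ltW.
rewrite -(ler_pM2r d0); apply: le_trans (bern j) _.
by rewrite mulrDr mulr1 mulrC; lra.
Qed.

(** As [1 - p] is at least one half, the first power not above [a] cannot have dropped below
    [a / 2]. *)
Lemma exists_expr_between (R : realType) (p a : R) : 0 < p <= 2^-1 -> 0 < a <= 1 ->
  exists k, a / 2 <= (1 - p) ^+ k <= a.
Proof.
case/andP=> p0 p1 /andP[a0 a1].
have [|k0 k0a] := @exists_expr_le _ p a _ a0; first by lra.
have ex : exists k, (1 - p) ^+ k <= a by exists k0.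
case: (ex_minnP ex) => -[|k] ka kmin; [exists 0%N | exists k.+1]; rewrite ka andbT.
  by rewrite expr0; lra.
have : a < (1 - p) ^+ k by rewrite ltNge; apply/negP => /kmin; rewrite ltnn.
rewrite exprS => ak; have : (1 - p) * a <= (1 - p) * (1 - p) ^+ k.
  by rewrite ler_wpM2l ?ltW //; lra.
by apply: le_trans; nra.
Qed.

(* [s] is the side of the empty rectangles and [(16 * s).+1] the size of Y. *)
Lemma exists_gadget_size (R : realType) (p r : R) : 0 < p <= 1 -> 0 < r <= 1 ->
  exists s n : nat, [/\ (0 < s)%N, 16 * s%:R <= n%:R * r <= 16 * s%:R + 1
  & n%:R * (2 ^+ (n + (16 * s).+1) * (1 - p) ^+ (s * s)) <= 1].
Proof.
move=> /andP[p0 p1] /andP[r0 r1].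
have q0 : 0 <= 1 - p by rewrite subr_ge0.
have rV0 : 0 <= r^-1 by rewrite invr_ge0 ltW.
(* [J] bounds the ratio of [n + m] to [s]: with [n] at most [16 * s / r + 1] and [m = 16 * s + 1],
   the sum is at most [s * (16 / r + 18)]. It does not depend on [s], which can then be taken large
   enough for [4 ^+ J * (1 - p) ^+ s <= 1]. *)
have := @archi_boundP R (16 / r + 18); set J := Num.bound _ => Jgt.
have {}Jgt : 16 / r + 18 < J%:R by apply: Jgt; lra.
have [||j jle] := @exists_expr_le _ p (4 ^+ J)^-1; first by rewrite p0.
  by rewrite invr_gt0 exprn_gt0.
pose s := j.+1; pose n := (Num.truncn (16 * s%:R / r)).+1.
have s1 : 1 <= s%:R :> R by rewrite ler1n.
have sle : 4 ^+ J * (1 - p) ^+ s <= 1.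
  rewrite -ler_pdivlMl ?exprn_gt0 // mulr1; apply: le_trans jle.
  by apply: ler_wiXn2l => //; lra.
have x0 : 0 <= 16 * s%:R / r by rewrite !mulr_ge0.
have := truncn_itv x0; rewrite -/n => /andP[nle nlt].
have {}nle : n%:R <= 16 * s%:R / r + 1 by rewrite /n -natr1 lerD2r.
exists s, n; split => //.
  rewrite -ler_pdivrMr // (ltW nlt) /=.
  have : n%:R * r <= (16 * s%:R / r + 1) * r by rewrite ler_wpM2r // ltW.
  by rewrite mulrDl divfK ?gt_eqF //; lra.
have nmle : (n + (16 * s).+1 <= s * J)%N.
  rewrite -(ler_nat R) natrD -natr1 !natrM.
  have : s%:R * (16 / r + 18) <= s%:R * J%:R by rewrite ler_wpM2l // ltW.
  lra.
(* Both [n] and [2 ^ (n + m)] are at most [2 ^ (s * J)]. *)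
have n2 : n%:R * 2 ^+ (n + (16 * s).+1) <= (4 ^+ J) ^+ s :> R.
  have -> : (4 ^+ J) ^+ s = (2 ^ (s * J + s * J))%:R :> R.
    rewrite natrX addnn -mul2n exprM -exprM (mulnC J); congr (_ ^+ _).
    by rewrite -natrX.
  rewrite -natrX -natrM ler_nat [leqRHS]expnD; apply: leq_mul; last by rewrite leq_pexp2l.
  apply: leq_trans (leq_trans _ nmle) (ltnW (ltn_expl _ (ltnSn 1))).
  exact: leq_addr.
rewrite mulrA exprM; apply: le_trans (_ : (4 ^+ J) ^+ s * ((1 - p) ^+ s) ^+ s <= _).
  by rewrite ler_wpM2r // !exprn_ge0.
by rewrite -exprMn exprn_ile1 // mulr_ge0 ?exprn_ge0.
Qed.

Theorem theorem7p3 (R : realType) :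
  exists p0 eps0 c : R,
    [/\ 0 < p0 < 1, 0 < eps0 < 1, 0 < c &
      forall p eps : R, 0 < p <= p0 -> 0 < eps <= eps0 ->
        exists (V : finType) (G : sgraph V),
          bipartite G /\
          forall alg : algorithm R G,
            approximate p eps alg ->
            exists s : seed alg,
              0 < seed_prob s /\ c / (eps * p) <= (max_degree (query s))%:R].
Proof.
(* The bounds on [p] and [eps] let [exists_expr_between] apply with [a = 8 * eps <= 1]; since
   [r <= 8 * eps], the constant 1/64 limits the gain from queried X-Y edges to [m / 8]. *)
exists 2^-1, 8^-1, 64^-1; split; try lra.
move=> p eps /andP[p0 p1] /andP[e0 e1].
have [||k /andP[rge rle]] := @exists_expr_between _ p (8 * eps); try lra.
set r := (1 - p) ^+ k in rge rle.
have r0 : 0 < r by lra.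
have r1 : r <= 1 by lra.
have [||s [n [s0 /andP[Nge Nle] small]]] := @exists_gadget_size _ p r; try lra.
have s1 : 1 <= s%:R :> R by rewrite ler1n.
have mE : (16 * s).+1%:R = 16 * s%:R + 1 :> R by rewrite -addn1 natrD natrM.
move: (16 * s).+1 (ltn0Sn (16 * s)) mE small => m m0 mE small.
exists (vtx n m k), (gadget n m k); split; first exact: gadget_bipartite.
move=> alg apx.
have [/existsP[t /andP[]]|/existsPn none] := boolP [exists t : seed alg,
  (0 < seed_prob t) && (64^-1 / (eps * p) <= (max_degree (query t))%:R)].
  by exists t.
exfalso.
have p01 : 0 <= p <= 1 by lra.
have : expected_output p alg <=
    n%:R - n%:R * r + 64^-1 / (eps * p) * m%:R * (p * r).
  apply: expected_output_le => // t t0.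
  by have := none t; rewrite t0 /= -ltNge => /ltW.
rewrite leNgt => /negP; apply.
have := @expect_matching_number_ge n m k R p p01 s m0.
rewrite -/r => mu.
apply: lt_le_trans apx.
(* Write N for [n%:R * r], so that [16 * s <= N <= m]. The second-moment loss is at most (1 + N) / 4
   as N is at most [m], and [eps * n] is at most N / 4. The gap to the algorithm is then at least N
   / 2 - s - 5/4 - m / 8, hence at least 5 s - 11/8, which is positive. *)
apply: (@lt_le_trans _ _ ((1 - eps) * (n%:R - s%:R - (1 + n%:R * r) / 4 - 1))).
  rewrite (_ : _ * m%:R * _ = m%:R * (r / eps) / 64); last first.
    by field; rewrite !gt_eqF.
  have : m%:R * (r / eps) <= m%:R * 8 by rewrite ler_wpM2l // ler_pdivrMr.
  have : 4 * eps * n%:R <= r * n%:R by rewrite ler_wpM2r //; lra.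
  have : 0 <= eps * (s%:R + (1 + n%:R * r) / 4 + 1).
    by apply: mulr_ge0; lra.
  lra.
apply: ler_wpM2l; first lra.
apply: le_trans mu.
apply: lerB => //; apply: lerB => //.
rewrite ler_pdivrMr ?mulr_gt0 ?ltr0n //.
have : n%:R * r * (1 + n%:R * r) <= m%:R * (1 + n%:R * r).
  by rewrite ler_wpM2r ?addr_ge0 //; lra.
lra.
Qed.
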